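(* Let $E$ be a truncated Riesz space with truncation $x\mapsto\bar{x}$, and let $E\oplus\mathbb{R}$ be its Alexandroff unitization. Then $E\oplus\mathbb{R}$ is Archimedean if and only if $E$ is Archimedean and the truncation satisfies $(\tau_3)$: for every $a\in E^{+}$, if $\overline{na}=na$ for all $n\in\mathbb{N}$, then $a=0$.
   Context: A truncation on a (real) Riesz space $E$ is a map $x\mapsto\bar{x}$ from $E^{+}$ to $E^{+}$ such that for all $a,b\in E^{+}$: $(\tau_1)$ $a\wedge\bar{b}\leq\bar{a}\leq a$; $(\tau_2)$ $\bar{a}=0$ implies $a=0$. A truncated Riesz space is a Riesz space $E$ equipped with a truncation (condition $(\tau_3)$ is not assumed unless stated). The set of fixed points is $\bar{E}=\{x\in E:\overline{|x|}=|x|\}$. The (Alexandroff) unitization $E\oplus\mathbb{R}=\{x+\lambda: x\in E,\lambda\in\mathbb{R}\}$ is the vector space $E\times\mathbb{R}$ (with $E$ identified with $E\times\{0\}$ and $\mathbb{R}$ with $\{0\}\times\mathbb{R}$, so $1=(0,1)$), ordered by the positive cone $(E\oplus\mathbb{R})^{+}=E^{+}\cup\{x+\lambda: x\in E,\ \lambda\in\mathbb{R},\ \lambda>0,\ \tfrac{1}{\lambda}x^{-}\in\bar{E}\}$. It is known that $E\oplus\mathbb{R}$ is a Riesz space, that $E$ is a vector sublattice (indeed a maximal ideal) of it, and that $\bar{x}=x\wedge 1$ for all $x\in E^{+}$. *)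

(* Defs.v *)
From HB Require Import structures.
From mathcomp Require Import all_boot all_order all_algebra reals.

Set Implicit Arguments.
Unset Strict Implicit.
Unset Printing Implicit Defensive.

Import Order.TTheory GRing.Theory Num.Theory.
Local Open Scope ring_scope.

(* The library's joint hierarchy of lattices and additive groups starts at
   [realDomainType], and HB accepts no join of the two placed below it, so a
   Riesz space is a partially ordered [lmodType] with its own meet and join. *)
HB.mixin Record isRiesz (R : realType) E
    of GRing.Lmodule R E & Order.POrder ring_display E := {
  rz_meet : E -> E -> E;
  rz_join : E -> E -> E;
  rz_lexI : forall z x y : E, (z <= rz_meet x y) = (z <= x) && (z <= y);
  rz_leUx : forall x y z : E, (rz_join x y <= z) = (x <= z) && (y <= z);
  rz_leD2r : forall z x y : E, x <= y -> x + z <= y + z;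
  rz_scale_ge0 : forall (a : R) (x : E), 0 <= a -> 0 <= x -> 0 <= a *: x
}.

#[short(type="rieszType")]
HB.structure Definition Riesz (R : realType) :=
  { E of isRiesz R E & GRing.Lmodule R E & Order.POrder ring_display E }.

Definition rz_abs (R : realType) (E : rieszType R) (x : E) : E :=
  rz_join x (- x).

Definition rz_neg (R : realType) (E : rieszType R) (x : E) : E :=
  rz_join (- x) 0.

Definition rz_archimedean (R : realType) (E : rieszType R) : Prop :=
  forall x y : E, 0 <= x -> 0 <= y -> (forall n : nat, x *+ n <= y) -> x = 0.

(* A truncation is a map from E^+ to E^+: only the values of [trunc] on the
   positive cone are constrained, and only those are ever used. *)
HB.mixin Record hasTruncation (R : realType) E of Riesz R E := {
  trunc : E -> E;
  trunc_ge0 : forall a : E, 0 <= a -> 0 <= trunc a;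
  trunc_tau1 : forall a b : E, 0 <= a -> 0 <= b ->
    rz_meet a (trunc b) <= trunc a /\ trunc a <= a;
  trunc_tau2 : forall a : E, 0 <= a -> trunc a = 0 -> a = 0
}.

#[short(type="truncRieszType")]
HB.structure Definition TruncRiesz (R : realType) :=
  { E of hasTruncation R E & Riesz R E }.

Definition trunc_tau3 (R : realType) (E : truncRieszType R) : Prop :=
  forall a : E, 0 <= a -> (forall n : nat, trunc (a *+ n) = a *+ n) -> a = 0.

Definition trunc_fixed (R : realType) (E : truncRieszType R) : {pred E} :=
  [pred x : E | trunc (rz_abs x) == rz_abs x].

(* The pair (x, l) stands for the formal sum x + l. *)
Definition unitization (R : realType) (E : truncRieszType R) : Type :=
  (E * R^o)%type.

Section RieszFacts.
Variables (R : realType) (E : rieszType R).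
Implicit Types (x y z : E) (a b : R).

Lemma rz_leUl x y : x <= rz_join x y.
Proof. by have := lexx (rz_join x y); rewrite rz_leUx => /andP[]. Qed.

Lemma rz_leUr x y : y <= rz_join x y.
Proof. by have := lexx (rz_join x y); rewrite rz_leUx => /andP[]. Qed.

Lemma rz_leIl x y : rz_meet x y <= x.
Proof. by have := lexx (rz_meet x y); rewrite rz_lexI => /andP[]. Qed.

Lemma rz_leIr x y : rz_meet x y <= y.
Proof. by have := lexx (rz_meet x y); rewrite rz_lexI => /andP[]. Qed.

Lemma rz_meet_l x y : x <= y -> rz_meet x y = x.
Proof. by move=> xy; apply/eqP; rewrite eq_le rz_leIl rz_lexI lexx. Qed.

Lemma rz_meet_r x y : y <= x -> rz_meet x y = y.
Proof. by move=> xy; apply/eqP; rewrite eq_le rz_leIr rz_lexI lexx andbT. Qed.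

Lemma rz_join_l x y : y <= x -> rz_join x y = x.
Proof. by move=> xy; apply/eqP; rewrite eq_le rz_leUl rz_leUx lexx xy. Qed.

Lemma rz_subr_ge0 x y : (0 <= y - x) = (x <= y).
Proof.
apply/idP/idP => h; last by rewrite -(subrr x); apply: rz_leD2r.
by have := rz_leD2r x _ _ h; rewrite add0r subrK.
Qed.

Lemma rz_add_ge0 x y : 0 <= x -> 0 <= y -> 0 <= x + y.
Proof.
by move=> x0 y0; apply: le_trans y0 _; have := rz_leD2r y _ _ x0; rewrite add0r.
Qed.

Lemma rz_lerD x y z t : x <= y -> z <= t -> x + z <= y + t.
Proof.
rewrite -!(rz_subr_ge0 _ y) -(rz_subr_ge0 z) -(rz_subr_ge0 (x + z)) => h1 h2.
by rewrite opprD addrACA rz_add_ge0.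
Qed.

Lemma rz_scale_le a x y : 0 <= a -> x <= y -> a *: x <= a *: y.
Proof.
by move=> a0; rewrite -rz_subr_ge0 -(rz_subr_ge0 (a *: x)) -scalerBr;
  apply: rz_scale_ge0.
Qed.

Lemma rz_abs_id x : 0 <= x -> rz_abs x = x.
Proof.
move=> x0; apply: rz_join_l; apply: le_trans (x0).
by rewrite -rz_subr_ge0 sub0r opprK.
Qed.

Lemma rz_neg_ge0 x : 0 <= rz_neg x.
Proof. exact: rz_leUr. Qed.

End RieszFacts.

Section Unitization.
Variables (R : realType) (E : truncRieszType R).
Implicit Types (x y f g : E) (a b l : R).

HB.instance Definition _ := GRing.Lmodule.on (unitization E).

Implicit Types (u v w : unitization E).

Definition unitization_cone u : bool :=
  ((0 <= u.1) && (u.2 == 0))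
  || ((0 < u.2) && (u.2^-1 *: rz_neg u.1 \in @trunc_fixed R E)).

Definition unitization_le u v : bool := unitization_cone (v - u).

Let fixed f := 0 <= f /\ trunc f = f.

Let fixed_trunc x : 0 <= x -> fixed (trunc x).
Proof.
move=> x0; have t0 := trunc_ge0 x x0; split => //.
have [h1 h2] := trunc_tau1 _ _ t0 x0.
by apply/eqP; rewrite eq_le h2 -[X in X <= _](rz_meet_l (lexx _)).
Qed.

Let fixed_solid f g : 0 <= f -> f <= g -> fixed g -> fixed f.
Proof.
move=> f0 fg [g0 gE]; split => //; have [h1 h2] := trunc_tau1 _ _ f0 g0.
by apply/eqP; rewrite eq_le h2; move: h1; rewrite gE (rz_meet_l fg).
Qed.

Let fixed_le_trunc f x : fixed f -> f <= x -> f <= trunc x.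
Proof.
move=> [f0 fE] fx; have [h _] := trunc_tau1 _ _ (le_trans f0 fx) f0.
by move: h; rewrite fE (rz_meet_r fx).
Qed.

Let fixed_join f g : fixed f -> fixed g -> fixed (rz_join f g).
Proof.
move=> Ff Fg; have j0 : 0 <= rz_join f g by apply: le_trans (proj1 Ff) (rz_leUl _ _).
split=> //; apply/eqP; rewrite eq_le rz_leUx !fixed_le_trunc ?rz_leUl ?rz_leUr //.
by have [_ ->] := trunc_tau1 _ _ j0 j0.
Qed.

Let fixed0 : fixed 0.
Proof.
split=> //; apply/eqP.
by have [_ h] := trunc_tau1 _ _ (lexx (0 : E)) (lexx 0); rewrite eq_le h trunc_ge0.
Qed.

Let coneP u :
  reflect (0 <= u.2 /\ exists2 f, fixed f & 0 <= u.1 + u.2 *: f)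
          (unitization_cone u).
Proof.
apply: (iffP orP) => [[/andP[x0 /eqP->]|/andP[l0]]|[l0 [f Ff h]]].
- by split=> //; exists 0; rewrite // scaler0 addr0.
- have n0 : 0 <= u.2^-1 *: rz_neg u.1.
    by apply: rz_scale_ge0 (rz_neg_ge0 _); rewrite invr_ge0 ltW.
  rewrite inE rz_abs_id // => /eqP tE; split; first exact: ltW.
  exists (u.2^-1 *: rz_neg u.1) => //.
  rewrite scalerA divff ?lt0r_neq0 // scale1r addrC -[X in _ <= _ + X]opprK.
  by rewrite rz_subr_ge0 rz_leUl.
move: l0; rewrite le_eqVlt eq_sym => /orP[/eqP l0|l0].
  by left; move: h; rewrite l0 scale0r addr0 eqxx => ->.
right; rewrite l0 inE.
have n0 : 0 <= u.2^-1 *: rz_neg u.1.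
  by apply: rz_scale_ge0 (rz_neg_ge0 _); rewrite invr_ge0 ltW.
rewrite rz_abs_id //; apply/eqP; apply: (proj2 (fixed_solid n0 _ Ff)).
have -> : f = u.2^-1 *: (u.2 *: f) by rewrite scalerA mulVf ?lt0r_neq0 ?scale1r.
apply: rz_scale_le; first by rewrite invr_ge0 ltW.
rewrite rz_leUx rz_scale_ge0 ?(ltW l0) ?andbT //; last by case: Ff.
by rewrite -rz_subr_ge0 opprK addrC.
Qed.

Let coneD u v :
  unitization_cone u -> unitization_cone v -> unitization_cone (u + v).
Proof.
move=> /coneP[l0 [f Ff hf]] /coneP[m0 [g Fg hg]]; apply/coneP.
split; first exact: addr_ge0.
exists (rz_join f g); first exact: fixed_join.
rewrite /= scalerDl addrACA; apply: rz_add_ge0.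
  apply: le_trans hf _; apply: rz_lerD => //.
  by apply: rz_scale_le => //; apply: rz_leUl.
apply: le_trans hg _; apply: rz_lerD => //.
by apply: rz_scale_le => //; apply: rz_leUr.
Qed.

Let coneN0 u : unitization_cone u -> unitization_cone (- u) -> u = 0.
Proof.
move=> /coneP[l0 [f Ff hf]] /coneP[m0 [g Fg hg]].
have l_eq0 : u.2 = 0.
  by apply/eqP; rewrite eq_le l0 andbT; move: m0; rewrite /= oppr_ge0.
move: hf hg; rewrite /= l_eq0 oppr0 !scale0r !addr0 => hf hg.
rewrite [u]surjective_pairing l_eq0; congr pair; apply/eqP.
by rewrite eq_le hf andbT -rz_subr_ge0 sub0r.
Qed.

Let le_refl : reflexive unitization_le.
Proof. by move=> u; rewrite /unitization_le subrr /unitization_cone lexx eqxx. Qed.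

Let le_anti : antisymmetric unitization_le.
Proof.
move=> u v /andP[h1 h2]; apply/esym/subr0_eq; apply: coneN0 => //.
by rewrite opprB.
Qed.

Let le_trans' : transitive unitization_le.
Proof.
by move=> v u w h1 h2; have := coneD h2 h1; rewrite /unitization_le subrKA.
Qed.

HB.instance Definition _ :=
  Order.Le_isPOrder.Build ring_display (unitization E) le_refl le_anti le_trans'.

(* For l >= 0, the positive part of x - l lies in E: it is x^+ - (x^+ /\ l),
   and x^+ /\ l = l * trunc (x^+ / l) when l > 0. *)
Definition unitization_cut x l : E :=
  rz_join x 0 - l *: trunc (l^-1 *: rz_join x 0).

Definition unitization_pos u : unitization E :=
  if u.2 <= 0 then (unitization_cut u.1 (- u.2), 0)
  else u + (unitization_cut (- u.1) u.2, 0).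

Definition unitization_join u v : unitization E := v + unitization_pos (u - v).

Definition unitization_meet u v : unitization E :=
  - unitization_join (- u) (- v).

Let cutP x l w : 0 <= l ->
  unitization_cone (w - (unitization_cut x l, 0))
    = unitization_cone w && unitization_cone (w - (x, - l)).
Proof.
move=> l0; set s := unitization_cut x l.
have p0 : 0 <= rz_join x 0 by apply: rz_leUr.
have q0 : 0 <= l^-1 *: rz_join x 0 by rewrite rz_scale_ge0 ?invr_ge0.
have Fq := fixed_trunc q0.
apply/idP/andP => [h|[/coneP[m0 [f Ff hf]] /coneP[n0 [g Fg hg]]]].
- split.
    rewrite -[w](subrK ((s, 0) : unitization E)); apply: coneD => //.
    apply/coneP; split=> //=; exists 0 => //.
    rewrite scaler0 addr0 /s /unitization_cut rz_subr_ge0.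
    have := l0; rewrite le_eqVlt => /orP[/eqP<-|l1]; first by rewrite scale0r.
    have [_ h'] := trunc_tau1 _ _ q0 q0; apply: le_trans (rz_scale_le l0 h') _.
    by rewrite scalerA divff ?lt0r_neq0 // scale1r.
  rewrite -(subrKA ((s, 0) : unitization E)); apply: coneD => //.
  apply/coneP; split; first by rewrite /= opprK add0r.
  exists (trunc (l^-1 *: rz_join x 0)) => //=.
  by rewrite opprK add0r addrAC /s /unitization_cut subrK rz_subr_ge0 rz_leUl.
apply/coneP; split; first by rewrite /= subr0.
pose h := rz_join f g; have Fh : fixed h by exact: fixed_join.
exists h => //=; rewrite subr0.
have lh0 : 0 <= l *: h by apply: rz_scale_ge0 => //; case: Fh.
have le1 : rz_meet (l *: h) (rz_join x 0)
             <= l *: trunc (l^-1 *: rz_join x 0).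
  have := l0; rewrite le_eqVlt => /orP[/eqP<-|l1]; first by rewrite !scale0r rz_leIl.
  have k0 : 0 <= rz_meet (l *: h) (rz_join x 0) by rewrite rz_lexI lh0.
  have -> : rz_meet (l *: h) (rz_join x 0)
      = l *: (l^-1 *: rz_meet (l *: h) (rz_join x 0)).
    by rewrite scalerA divff ?lt0r_neq0 // scale1r.
  apply: rz_scale_le => //.
  have li0 : 0 <= l^-1 by rewrite invr_ge0.
  apply: fixed_le_trunc; last by apply: rz_scale_le => //; apply: rz_leIr.
  apply: fixed_solid Fh; first exact: rz_scale_ge0.
  apply: le_trans (rz_scale_le li0 (rz_leIl _ _)) _.
  by rewrite scalerA mulVf ?lt0r_neq0 // scale1r.
have hf' : 0 <= w.1 + w.2 *: h.
  apply: le_trans hf _; apply: rz_lerD => //.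
  by apply: rz_scale_le => //; apply: rz_leUl.
have hg' : x <= w.1 + w.2 *: h + l *: h.
  move: n0 hg; rewrite /= opprK => n0 hg.
  rewrite -rz_subr_ge0.
  have -> : w.1 + w.2 *: h + l *: h - x = w.1 - x + (w.2 + l) *: h.
    by rewrite scalerDl addrA [w.1 - x + _]addrAC [RHS]addrAC.
  apply: le_trans hg _; apply: rz_lerD => //.
  by apply: rz_scale_le => //; apply: rz_leUr.
rewrite addrAC rz_subr_ge0 /s /unitization_cut.
set t := l *: trunc _ in le1 *; set z := w.1 + w.2 *: h in hf' hg' *.
suff : rz_join x 0 - z <= t.
  by rewrite -(rz_subr_ge0 _ t) -(rz_subr_ge0 _ z) !opprB addrCA.
apply: le_trans le1; rewrite rz_lexI; apply/andP; split; last first.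
  by rewrite -rz_subr_ge0 opprB addrCA subrr addr0.
rewrite -rz_subr_ge0 opprB addrA rz_subr_ge0 addrC rz_leUx hg' /=.
exact: rz_add_ge0.
Qed.

Let posP u w : unitization_cone (w - unitization_pos u)
  = unitization_cone w && unitization_cone (w - u).
Proof.
rewrite /unitization_pos; case: ifPn => [u0|].
  by rewrite cutP ?oppr_ge0 // opprK -surjective_pairing.
rewrite -ltNge => u0; rewrite opprD addrA cutP ?ltW //.
have -> : (- u.1, - u.2) = - u by case: u {u0}.
by rewrite opprK subrK andbC.
Qed.

Let joinP u v w : (unitization_join u v <= w) = (u <= w) && (v <= w).
Proof.
rewrite -![_ <= _]/(unitization_cone (_ - _)) opprD addrA posP.
by rewrite opprB addrA subrK andbC.
Qed.

Let leN2 u v : (- u <= - v) = (v <= u).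
Proof. by rewrite -![_ <= _]/(unitization_cone (_ - _)) opprK addrC. Qed.

Let meetP u v w : (u <= unitization_meet v w) = (u <= v) && (u <= w).
Proof. by rewrite /unitization_meet -leN2 opprK joinP !leN2. Qed.

Let leD2r w u v : u <= v -> u + w <= v + w.
Proof.
rewrite -[_ <= _]/(unitization_cone (v - u)) => uv.
rewrite -[_ <= _]/(unitization_cone (v + w - (u + w))).
by rewrite opprD addrACA subrr addr0.
Qed.

Let scale_ge0 (a : R) u : 0 <= a -> 0 <= u -> 0 <= a *: u.
Proof.
move=> a0; rewrite -[0 <= u]/(unitization_cone (u - 0)) subr0.
rewrite -[0 <= a *: u]/(unitization_cone (a *: u - 0)) subr0.
move=> /coneP[l0 [f Ff hf]]; apply/coneP; split; first exact: mulr_ge0.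
by exists f => //=; rewrite -scalerA -scalerDr rz_scale_ge0.
Qed.

HB.instance Definition _ := isRiesz.Build R (unitization E) meetP joinP leD2r scale_ge0.

Lemma unitization_ge0 u : (0 <= u) = unitization_cone u.
Proof. by rewrite -[0 <= u]/(unitization_cone (u - 0)) subr0. Qed.

End Unitization.

(* Main.v *)
(** If [n u <= v] in the unitization, then [u] has no scalar part, and
    [n x <= y + m] with [x, y, m >= 0]. For fixed [k], every multiple of
    [(k x - y)^+] satisfies [n (k x - y)^+ <= (n k x - y)^+ <= m], so
    [(tau_3)] forces [k x <= y]; since [k] is arbitrary, [x = 0] as [E] is
    Archimedean. *)
Require Import Defs.
From mathcomp Require Import all_boot all_order all_algebra reals.

Set Implicit Arguments.
Unset Strict Implicit.
Unset Printing Implicit Defensive.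

Import Order.TTheory GRing.Theory Num.Theory.
Local Open Scope ring_scope.

Lemma mulrn_ubound_eq0 (R : realType) (l m : R) :
  0 <= l -> (forall n : nat, l *+ n <= m) -> l = 0.
Proof.
move=> l0 h; apply/eqP; rewrite eq_le l0 andbT leNgt; apply/negP => lp.
have m0 : 0 <= m by have := h 0%N; rewrite mulr0n.
have := archi_boundP (divr_ge0 m0 l0).
by rewrite ltr_pdivrMr // mulr_natl ltNge h.
Qed.

Section RieszLemmas.
Variables (R : realType) (E : rieszType R).
Implicit Types x y : E.

Lemma rz_mulrn_ge0 x n : 0 <= x -> 0 <= x *+ n.
Proof. by move=> x0; rewrite -scaler_nat rz_scale_ge0 ?ler0n. Qed.

(** For [n > 0], the element [y / n] is an upper bound of both [x] and [0], hence of their join. *)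
Lemma rz_pos_mulrn_le x y n :
  0 <= y -> x *+ n <= y -> rz_join x 0 *+ n <= y.
Proof.
case: n => [|n] y0 xy; first by rewrite mulr0n.
have n0 : 0 <= n.+1%:R :> R by [].
have nV0 : 0 <= n.+1%:R^-1 :> R by rewrite invr_ge0.
have nn0 : n.+1%:R != 0 :> R by rewrite pnatr_eq0.
have -> : y = n.+1%:R *: (n.+1%:R^-1 *: y).
  by rewrite scalerA divff // scale1r.
rewrite -scaler_nat; apply: rz_scale_le => //.
rewrite rz_leUx rz_scale_ge0 // andbT.
have -> : x = n.+1%:R^-1 *: (x *+ n.+1).
  by rewrite -scaler_nat scalerA mulVf // scale1r.
exact: rz_scale_le.
Qed.

End RieszLemmas.

Section TruncLemmas.
Variables (R : realType) (E : truncRieszType R).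
Implicit Types (x y f g : E) (u v : unitization E).

(** By [(tau_1)] with [b = g], [f = f /\ trunc g <= trunc f <= f]. *)
Lemma trunc_fixed_solid f g :
  0 <= f -> f <= g -> trunc g = g -> trunc f = f.
Proof.
move=> f0 fg gE; have [h1 h2] := trunc_tau1 _ _ f0 (le_trans f0 fg).
by apply/eqP; rewrite eq_le h2; move: h1; rewrite gE (rz_meet_l fg).
Qed.

Lemma unitization_leE u v : (u <= v) = unitization_cone (v - u).
Proof. by rewrite -rz_subr_ge0 unitization_ge0. Qed.

Lemma unitization_cone_embed x :
  unitization_cone ((x, 0) : unitization E) = (0 <= x).
Proof. by rewrite /unitization_cone /= eqxx ltxx andbT orbF. Qed.

Lemma unitization_cone_snd_ge0 u : unitization_cone u -> 0 <= u.2.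
Proof. by case/orP => /andP[] => [_ /eqP->|/ltW]. Qed.

Lemma unitization_mulrnE u n : u *+ n = (u.1 *+ n, u.2 *+ n).
Proof.
(* Scalar multiplication on pairs unfolds componentwise, so natural multiples are routed through
   it. *)
have H (V : lmodType R) (x : V) : x *+ n = (n%:R : R) *: x by rewrite scaler_nat.
by rewrite !H.
Qed.

Lemma unitization_archimedean_embed :
  rz_archimedean (unitization E) -> rz_archimedean E.
Proof.
move=> arch x y x0 y0 xy.
suff [] : ((x, 0) : unitization E) = 0 by [].
apply: (arch _ (y, 0)) => [||n].
- by rewrite unitization_ge0 unitization_cone_embed.
- by rewrite unitization_ge0 unitization_cone_embed.
rewrite unitization_leE unitization_mulrnE /= mul0rn.
have -> : ((y, 0) : unitization E) - (x *+ n, 0) = (y - x *+ n, 0).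
  by congr pair; rewrite /= subrr.
by rewrite unitization_cone_embed rz_subr_ge0.
Qed.

(** The negative part of [- x] is [x] itself, so the cone condition for [1 - x] is exactly that [x]
    is fixed. *)
Lemma unitization_le1 x : 0 <= x -> trunc x = x ->
  ((x, 0) : unitization E) <= (0, 1).
Proof.
move=> x0 xE; rewrite unitization_leE /unitization_cone /= subr0 ltr01.
rewrite invr1 scale1r sub0r /rz_neg opprK (rz_join_l x0).
by rewrite inE rz_abs_id // xE eqxx orbT.
Qed.

(** The unit [(0, 1)] bounds every multiple of [a], since these multiples are all fixed. *)
Lemma unitization_archimedean_tau3 :
  rz_archimedean (unitization E) -> trunc_tau3 E.
Proof.
move=> arch a a0 fixed_a.
suff [] : ((a, 0) : unitization E) = 0 by [].
apply: (arch _ (0, 1)) => [||n].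
- by rewrite unitization_ge0 unitization_cone_embed.
(* The multiple [a *+ 0] computes to [0], which gives [0 <= 1]. *)
- exact: unitization_le1 (fixed_a 0%N).
by rewrite unitization_mulrnE /= mul0rn unitization_le1 ?rz_mulrn_ge0.
Qed.

(** The right side is [(n k x - y)^+]. For [n > 0], [y <= y^+ <= n y^+] gives
    [n (k x - y^+) <= n k x - y], and the bound passes to positive parts. The inequality
    [y <= n y^+] may fail for [n = 0], which is treated apart. *)
Lemma mulrn_pos_le_neg x y k n :
  rz_join (x *+ k - rz_join y 0) 0 *+ n <= rz_neg (y - x *+ (k * n)).
Proof.
case: n => [|n]; first by rewrite mulr0n rz_neg_ge0.
apply: rz_pos_mulrn_le; first exact: rz_neg_ge0.
apply: le_trans (rz_leUl _ _).
rewrite mulrnBl -mulrnA opprB; apply: rz_lerD => //.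
rewrite -rz_subr_ge0 opprK addrC rz_subr_ge0.
apply: le_trans (rz_leUl y 0) _.
rewrite -rz_subr_ge0 mulrSr addrK; apply: rz_mulrn_ge0; exact: rz_leUr.
Qed.

(** The second hypothesis is the cone condition for [n x <= y + m]. As [m > 0] leaves the sign of
    [y] free, the bound is [y^+]. Every multiple of [p / m] lies below a fixed point, so it is fixed
    by solidity and [(tau_3)] applies to [p / m]. *)
Lemma tau3_mulrn_le (m : R) x y : trunc_tau3 E -> 0 < m ->
  (forall n, m^-1 *: rz_neg (y - x *+ n) \in @trunc_fixed R E) ->
  forall k, x *+ k <= rz_join y 0.
Proof.
move=> tau3 m0 fixed_n k.
set p := rz_join (x *+ k - rz_join y 0) 0.
have mV0 : 0 <= m^-1 by rewrite invr_ge0 ltW.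
have p0 : 0 <= p by exact: rz_leUr.
have mp0 : 0 <= m^-1 *: p by exact: rz_scale_ge0.
have mp_eq0 : m^-1 *: p = 0.
  apply: tau3 => // n.
  apply: (@trunc_fixed_solid _ (m^-1 *: rz_neg (y - x *+ (k * n)))).
  - exact: rz_mulrn_ge0.
  - by rewrite scalerMnr; apply: rz_scale_le (mulrn_pos_le_neg _ _ _ _).
  have := fixed_n (k * n)%N; rewrite inE rz_abs_id => [/eqP //|].
  exact: rz_scale_ge0 (rz_neg_ge0 _).
have p_eq0 : p = 0.
  by rewrite -[p]scale1r -(divff (lt0r_neq0 m0)) -scalerA mp_eq0 scaler0.
have : x *+ k - rz_join y 0 <= 0 by rewrite -[leRHS]p_eq0; exact: rz_leUl.
by rewrite -rz_subr_ge0 sub0r opprB rz_subr_ge0.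
Qed.

Lemma archimedean_unitization :
  rz_archimedean E -> trunc_tau3 E -> rz_archimedean (unitization E).
Proof.
move=> arch tau3 [x l] [y m]; rewrite !unitization_ge0 => u0 v0 uv.
have {}uv n : unitization_cone ((y - x *+ n, m - l *+ n) : unitization E).
  by have := uv n; rewrite unitization_leE unitization_mulrnE.
(* Scalar parts of cone elements are nonnegative, so [n l <= m] for all [n]. *)
have l_eq0 : l = 0.
  apply: (@mulrn_ubound_eq0 R l m) => [|n].
    exact: (unitization_cone_snd_ge0 u0).
  by have := unitization_cone_snd_ge0 (uv n); rewrite /= subr_ge0.
move: u0; rewrite l_eq0 unitization_cone_embed => x0.
have {}uv n : unitization_cone ((y - x *+ n, m) : unitization E).
  by have := uv n; rewrite l_eq0 mul0rn subr0.
suff x_eq0 : x = 0 by rewrite x_eq0.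
apply: (arch x (rz_join y 0)) => // [|n]; first exact: rz_leUr.
(* If [m = 0], the inequalities already hold in [E]; only [m > 0] calls for [(tau_3)]. *)
have := unitization_cone_snd_ge0 v0; rewrite /= le_eqVlt => /orP[/eqP m_eq0|m0].
  have := uv n; rewrite -m_eq0 unitization_cone_embed rz_subr_ge0 => xy.
  exact: le_trans xy (rz_leUl _ _).
apply: (tau3_mulrn_le tau3 m0) => k.
by have := uv k; rewrite /unitization_cone /= gt_eqF // andbF m0.
Qed.

End TruncLemmas.

Theorem theorem3p1 (R : realType) (E : truncRieszType R) :
  rz_archimedean (unitization E) <-> rz_archimedean E /\ trunc_tau3 E.
Proof.
split=> [arch|[arch tau3]]; last exact: archimedean_unitization.
split; first exact: unitization_archimedean_embed.
exact: unitization_archimedean_tau3.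
Qed.
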